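(* Let $A=(a_{ij})\in\mathbb Z^{\ell\times n}$ be a nonzero matrix of rank $r\le \ell$, and let $J=(J_1,\dots,J_\ell):\mathbb C^n\to\mathbb R^\ell$, $J_i(z,\overline z)=\sum_{j=1}^n a_{ij}z_j\overline z_j$, be the moment map of the linear Hamiltonian torus action with weight matrix $A$. Then the following statements are equivalent: (i) $J$ changes sign at every $\zeta\in Z=J^{-1}(0)$; (ii) the image of $J$ is a vector subspace of $\mathbb R^\ell$ of dimension $r$; (iii) $0$ is in the relative interior of the convex hull $\operatorname{conv}(A)\subset\mathbb R^\ell$ of the set of column vectors of $A$. More generally, for every $\mu\in\mathbb R^\ell$ the following holds: $\mu$ is in the relative interior of the image of $J$ if and only if $J^{-1}(\mu)\neq\emptyset$ and the shifted moment map $J_\mu:=J-\mu$ changes sign at every $\zeta\in J_\mu^{-1}(0)=J^{-1}(\mu)$.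
   Context: The torus $\mathbb T^\ell$ (the $\ell$-fold product of circles, with Lie algebra $\mathfrak g\cong\mathbb R^\ell$, $\mathfrak g^*\cong\mathbb R^\ell$) acts on $\mathbb C^n$ with weight matrix $A$: the element $(e^{2\pi \mathrm i\xi^1},\dots,e^{2\pi \mathrm i\xi^\ell})$ acts by $z_j\mapsto e^{-2\pi \mathrm i\sum_i a_{ij}\xi^i}z_j$. With respect to the symplectic form $-2\omega_0$, $\omega_0=\frac{\mathrm i}{2}\sum_j dz_j\wedge d\overline z_j$, the map $J$ is the unique homogeneous quadratic moment map. Sign change. Let $\Phi:\mathbb C^n\to\mathbb R^\ell$ be a moment map (here $\Phi=J$ or $\Phi=J_\mu$), and for $\xi\in\mathbb R^\ell$ put $\Phi_\xi:=\sum_i\xi^i\Phi_i$. One says that $\Phi$ changes sign at $\zeta\in\Phi^{-1}(0)$ if for every $\xi\in\mathbb R^\ell$ one of the following holds: - there is an open neighborhood $U$ of $\zeta$ in $\mathbb C^n$ such that $\Phi_\xi|_U=0$; or - for every open neighborhood $U$ of $\zeta$ in $\mathbb C^n$ there exist $m_1,m_2\in U$ with $\Phi_\xi(m_1)>0$ and $\Phi_\xi(m_2)<0$. By convention, if $0$ is not in the image of $\Phi$, then $\Phi$ does not change sign. The relative interior of a convex set is its interior within its affine hull. *)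

(* Defs.v *)
From HB Require Import structures.
From mathcomp Require Import all_boot all_order all_algebra.
From mathcomp Require Import complex.
From mathcomp Require Import all_classical all_reals topology normedtype convex.

Set Implicit Arguments.
Unset Strict Implicit.
Unset Printing Implicit Defensive.

Import Order.TTheory GRing.Theory Num.Theory.
Import numFieldNormedType.Exports.

Local Open Scope classical_set_scope.
Local Open Scope ring_scope.

(* Complex column vectors. The regular algebra [R[i]^o] is used instead of
   [R[i]] because it is the one that carries the topology of the norm. *)
Notation complexV R n := 'cV[(R[i])^o]_n.

Definition real_mx (R : realType) (l n : nat) (A : 'M[int]_(l, n)) :
  'M[R]_(l, n) := map_mx intr A.

(* The sum is real (lemma [moment_map_real]), so that [Re] only changes its
   type from [R[i]] to [R]. *)
Definition moment_map (R : realType) (l n : nat) (A : 'M[int]_(l, n))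
    (z : complexV R n) : 'cV[R]_l :=
  \col_i complex.Re (\sum_j (A i j)%:~R * (z j 0 : R[i]) * ((z j 0)^*)%C).

Lemma moment_map_real (R : realType) (l n : nat) (A : 'M[int]_(l, n))
    (z : complexV R n) (i : 'I_l) :
  ((moment_map A z i 0)%:C)%C =
  \sum_j (A i j)%:~R * (z j 0 : R[i]) * ((z j 0)^*)%C.
Proof.
rewrite mxE; have -> : \sum_j (A i j)%:~R * (z j 0 : R[i]) * ((z j 0)^*)%C =
    ((\sum_j (A i j)%:~R *
       (complex.Re (z j 0) ^+ 2 + complex.Im (z j 0) ^+ 2) : R)%:C)%C.
  rewrite rmorph_sum; apply: eq_bigr => j _.
  rewrite rmorphM rmorph_int -mulrA; congr (_ * _).
  case: (z j 0) => a b.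
  apply/eqP; rewrite eq_complex /= !mulrN opprK -!expr2 eqxx [b * a]mulrC.
  by rewrite addNr eqxx.
by [].
Qed.

Definition component (R : realType) (l : nat) (T : Type) (Phi : T -> 'cV[R]_l)
    (xi : 'cV[R]_l) (z : T) : R := \sum_i xi i 0 * Phi z i 0.

Definition changes_sign_at (R : realType) (l : nat) (T : topologicalType)
    (Phi : T -> 'cV[R]_l) (zeta : T) : Prop :=
  forall xi : 'cV[R]_l,
    (exists U : set T, open_nbhs zeta U /\
       forall m, U m -> component Phi xi m = 0) \/
    (forall U : set T, open_nbhs zeta U ->
       exists m1 m2 : T, [/\ U m1, U m2,
         0 < component Phi xi m1 & component Phi xi m2 < 0]).

Definition convex_hull (R : realType) (V : lmodType R) (S : set V) : set V :=
  smallest (@convex_set R V) S.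

Definition affine_set (R : realType) (V : lmodType R) (S : set V) : Prop :=
  forall (x y : V) (t : R), S x -> S y -> S (t *: x + (1 - t) *: y).

Definition affine_hull (R : realType) (V : lmodType R) (S : set V) : set V :=
  smallest (@affine_set R V) S.

(* [subspace B] has the topology induced on [B], with the points outside of [B]
   made isolated; this is harmless here as [S] is included in its affine hull. *)
Definition relative_interior (R : realType) (V : normedModType R) (S : set V) :
  set V := @interior (subspace (affine_hull S)) S.

(* Main.v *)
(* Put |z|^2 = (|z_1|^2, ..., |z_n|^2), so that J z = A |z|^2 and the image of J
   is the cone spanned by the columns of A. All the conditions on a value mu
   are compared with the single one that mu is a combination A s with all s_j > 0
   ([positive_combination]).

   If mu = A s with s > 0 and J zeta = mu, then J_xi - mu_xi is the sum of the
   c_j (|z_j|^2 - |zeta_j|^2), where c = xi^T A. Moving a single coordinate gives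
   both signs if c_j and zeta_j are nonzero for some j; otherwise the pairing of
   xi with mu vanishes, so the sum of the c_j s_j is 0 and the c_j take both
   signs, unless c = 0. Conversely, by Stiemke's theorem of the alternative, a
   point mu of the cone which is not such a combination has a xi with
   c >= 0, c <> 0 and zero pairing with mu, and then J_xi - mu_xi is
   nonnegative everywhere without vanishing near any point.

   If a relatively interior point p of a subset of the cone is pushed slightly
   away from a strictly positive combination w, it stays in the cone, so that p
   is strictly positive too; perturbing s gives the converse. *)
Require Import Defs.
From HB Require Import structures.
From mathcomp Require Import all_boot all_order all_algebra.
From mathcomp Require Import complex.
From mathcomp Require Import all_classical all_reals topology normedtype convex.
From mathcomp Require Import interval_inference.
From mathcomp Require Import ring lra.

Import Order.TTheory GRing.Theory Num.Theory.
Import numFieldNormedType.Exports.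

Local Open Scope classical_set_scope.
Local Open Scope ring_scope.

(** * Linear theorems of the alternative over an ordered field *)

Section Alternative.

Context {F : realFieldType} {l : nat}.

(* Tucker's induction on the columns: if [xi] fails on the new column [c], all
   the other columns are slid along [c] into the kernel of [xi]. *)
Lemma tucker (m : nat) (a : 'cV[F]_l) (B : 'M[F]_(l, m)) :
  exists (xi : 'rV[F]_l) (y0 : F) (y : 'cV[F]_m),
    [/\ 0 <= y0, forall j, 0 <= y j 0, y0 *: a + B *m y = 0,
        forall j, 0 <= (xi *m B) 0 j & 0 <= (xi *m a) 0 0
        /\ 0 < y0 + (xi *m a) 0 0].
Proof.
elim: m a B => [|m IHm] a B.
  have [->|a_neq0] := eqVneq a 0.
    exists 0, 1, 0; split=> //; first by case.
    - by rewrite scaler0 mulmx0 addr0.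
    - by case.
    - by rewrite mulmx0 mxE addr0 ltr01.
  exists a^T, 0, 0; split=> //; first by case.
  - by rewrite scale0r mulmx0 addr0.
  - by case.
  rewrite add0r; suff: 0 < (a^T *m a) 0 0 by move=> h; split=> //; exact: ltW.
  rewrite mxE lt_neqAle eq_sym psumr_neq0 => [|i _]; last first.
    by rewrite mxE -expr2 sqr_ge0.
  rewrite sumr_ge0 ?andbT => [|i _]; last by rewrite mxE -expr2 sqr_ge0.
  have [i [j]] := matrix0Pn _ a_neq0; rewrite (ord1 j) => aij.
  apply/hasP; exists i; first by rewrite mem_index_enum.
  by rewrite mxE -expr2 lt_neqAle sqr_ge0 eq_sym sqrf_eq0 aij.
pose c : 'cV_l := lsubmx (B : 'M_(l, 1 + m)).
pose B' : 'M_(l, m) := rsubmx (B : 'M_(l, 1 + m)).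
have mulB (w : 'rV_l) : w *m B = row_mx (w *m c) (w *m B').
  by rewrite -mul_mx_row hsubmxK.
have Bmul (x : 'cV_1) (y : 'cV_m) : B *m col_mx x y = c *m x + B' *m y.
  by rewrite -mul_row_col hsubmxK.
have [xi [y0 [y [y0_ge0 y_ge0 ay_eq0 xiB_ge0 [xia_ge0 y0xi_gt0]]]]] := IHm a B'.
set d := (xi *m c) 0 0.
have xic : xi *m c = d%:M by rewrite [LHS]mx11_scalar.
have rowP (w : 'rV_l) : 0 <= (w *m c) 0 0 -> (forall j, 0 <= (w *m B') 0 j) ->
    forall j, 0 <= (w *m B) 0 j.
  move=> wc wB j; rewrite mulB mxE.
  by case: (splitP (j : 'I_(1 + m))) => k _ //; rewrite ord1.
have [d_ge0|d_lt0] := leP 0 d.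
  exists xi, y0, (col_mx (0 : 'cV_1) y); split=> //; last exact: rowP.
    by move=> j; rewrite mxE; case: splitP => k _ //; rewrite mxE.
  by rewrite Bmul mulmx0 add0r.
(* With this [u], [xi] vanishes on [a + la0 *: c] and on all columns of [B' + c *m la], while [la0]
   and [la] stay nonnegative. *)
pose u := - d^-1.
have u_gt0 : 0 < u by rewrite oppr_gt0 invr_lt0.
pose la0 := u * (xi *m a) 0 0.
pose la := u *: (xi *m B').
have [v [z0 [z [z0_ge0 z_ge0 az_eq0 vB_ge0 [va_ge0 z0v_gt0]]]]] :=
  IHm (a + la0 *: c) (B' + c *m la).
set e := (v *m c) 0 0.
have vc : v *m c = e%:M by rewrite [LHS]mx11_scalar.
(* The multiple of [xi] is chosen so that [w] kills [c]. As [xi] vanishes on the slid columns, [w]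
   has on [a] and [B'] the values that [v] has on their slid versions. *)
pose w := v + (u * e) *: xi.
have wc : w *m c = 0.
  rewrite mulmxDl -scalemxAl vc xic scale_scalar_mx -raddfD /=.
  have -> : e + u * e * d = 0 by rewrite /u; field; rewrite lt_eqF.
  by rewrite raddf0.
have wa : w *m a = v *m (a + la0 *: c).
  rewrite mulmxDl -scalemxAl mulmxDr -scalemxAr vc [xi *m a]mx11_scalar.
  by rewrite !scale_scalar_mx; congr (_ + _%:M); rewrite /la0; ring.
have wB : w *m B' = v *m (B' + c *m la).
  rewrite mulmxDl -scalemxAl mulmxDr mulmxA vc mul_scalar_mx scalerA.
  by rewrite [e * u]mulrC.
(* The coefficient of [c] collects what all the slides contributed. *)
exists w, z0, (col_mx ((la0 * z0)%:M + la *m z : 'cV_1) z); split=> //.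
- move=> j; rewrite mxE; case: splitP => k _ //; rewrite ord1 mxE mxE eqxx mulr1n.
  apply: addr_ge0; first by rewrite !mulr_ge0 // ltW.
  rewrite mxE sumr_ge0 // => i _; rewrite mulr_ge0 // mxE.
  by rewrite mulr_ge0 // ltW.
- rewrite Bmul -[RHS]az_eq0 scalerDr mulmxDl -addrA; congr (_ + _).
  rewrite mulmxDr mul_mx_scalar mulmxA scalerA [la0 * z0]mulrC -addrA.
  by congr (_ + _); rewrite addrC.
- by apply: rowP => [|j]; [rewrite wc mxE | rewrite wB].
- by rewrite wa.
Qed.

(** Take each column in turn as the distinguished one in [tucker]: if the second alternative fails,
    [y0] must be positive, which gives a nonnegative kernel vector positive at [j]. Summing over [j]
    makes every entry positive. *)
Lemma stiemke (m : nat) (B : 'M[F]_(l, m)) :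
  (exists s : 'cV[F]_m, (forall j, 0 < s j 0) /\ B *m s = 0) \/
  (exists xi : 'rV[F]_l, (forall j, 0 <= (xi *m B) 0 j) /\
     exists j, 0 < (xi *m B) 0 j).
Proof.
have [|noxi] := pselect (exists xi : 'rV[F]_l,
  (forall j, 0 <= (xi *m B) 0 j) /\ exists j, 0 < (xi *m B) 0 j); first by right.
left; have /choice[x x_spec] : forall j, exists x : 'cV[F]_m,
    [/\ forall k, 0 <= x k 0, 0 < x j 0 & B *m x = 0].
  move=> j; have [xi [y0 [y [y0_ge0 y_ge0 By xiB [_ y0xi]]]]] :=
    tucker _ (col j B) B.
  have xij : (xi *m col j B) 0 0 = (xi *m B) 0 j by rewrite colE mulmxA -colE mxE.
  have y0_gt0 : 0 < y0.
    rewrite xij in y0xi; have [//|y0_le0] := ltP 0 y0.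
    case: noxi; exists xi; split=> //; exists j.
    by have := xiB j; lra.
  exists (y0 *: delta_mx j 0 + y); split.
  - by move=> k; rewrite !mxE addr_ge0 // mulr_ge0 // ler0n.
  - by rewrite !mxE !eqxx mulr1 ltr_wpDr.
  - by rewrite mulmxDr -scalemxAr -colE.
exists (\sum_j x j); split=> [j|]; last first.
  by rewrite mulmx_sumr big1 // => j _; have [_ _ ->] := x_spec j.
rewrite summxE (bigD1 j) //= ltr_wpDr ?sumr_ge0 // => [k _|].
  by have [] := x_spec k.
by have [] := x_spec j.
Qed.

Definition positive_combination {m : nat} (B : 'M[F]_(l, m)) (v : 'cV[F]_l) :=
  exists s : 'cV[F]_m, (forall j, 0 < s j 0) /\ B *m s = v.

(** This is [stiemke] for [B] augmented by the column [- (B *m t)]. A positive kernel vector,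
    divided by its last entry, represents [B *m t]. Otherwise [t >= 0] and the extra column force
    [xi] to vanish at [B *m t], so the strict inequality occurs at a column of [B]. *)
Lemma positive_or_supported (m : nat) (B : 'M[F]_(l, m)) (t : 'cV[F]_m) :
  (forall j, 0 <= t j 0) ->
  positive_combination B (B *m t) \/
  exists xi : 'rV[F]_l, [/\ forall j, 0 <= (xi *m B) 0 j,
    exists j, 0 < (xi *m B) 0 j & xi *m (B *m t) = 0].
Proof.
move=> t_ge0; have [[s [s_gt0 Bs0]]|[xi [xi_ge0 [j xi_gt0]]]] :=
  stiemke _ (row_mx B (- (B *m t))).
  pose c := s (rshift m 0) 0; left; exists (c^-1 *: usubmx s).
  have c_gt0 : 0 < c by exact: s_gt0.
  split=> [j|]; first by rewrite !mxE mulr_gt0 ?invr_gt0.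
  move: Bs0; rewrite -{1}[s]vsubmxK mul_row_col [dsubmx s]mx11_scalar.
  rewrite mul_mx_scalar !mxE -/c scalerN => /eqP; rewrite subr_eq0 => /eqP Bs.
  by rewrite -scalemxAr Bs scalerA mulVf ?scale1r // gt_eqF.
right; exists xi.
have xiB_ge0 k : 0 <= (xi *m B) 0 k.
  by have := xi_ge0 (lshift _ k); rewrite mul_mx_row row_mxEl.
have ge0 : 0 <= (xi *m (B *m t)) 0 0.
  by rewrite mulmxA mxE sumr_ge0 // => k _; rewrite mulr_ge0.
have eq0 : xi *m (B *m t) = 0.
  apply/matrixP=> i k; rewrite !ord1 [RHS]mxE; apply/eqP; rewrite eq_le ge0 andbT.
  by have := xi_ge0 (rshift m 0); rewrite mul_mx_row row_mxEr mulmxN mxE oppr_ge0.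
split=> //; move: xi_gt0; rewrite mul_mx_row mulmxN eq0 oppr0.
by rewrite mxE; case: splitP => k _; [exists k|rewrite mxE ltxx].
Qed.

End Alternative.

(** * Relative interiors and convex combinations *)

Section RelativeInterior.

Context {R : realType}.

(** Either side puts [p] in [S], hence in the affine hull, so the isolated points of the [subspace]
    topology never arise. *)
Lemma relative_interiorP {V : normedModType R} (S : set V) (p : V) :
  relative_interior S p <->
  S p /\ exists2 e : R, 0 < e & forall v, affine_hull S v -> ball p e v -> S v.
Proof.
have sub_hull : S `<=` affine_hull S by exact: sub_gen_smallest.
rewrite /relative_interior /interior; split=> [Sp|[Sp [e e_gt0 pe]]].
  have {}Sp' : S p by exact: nbhs_subspace_singleton Sp.
  split=> //; move: Sp; case: (nbhs_subspaceP (affine_hull S) p) => [_|/(_ (sub_hull _ Sp'))//].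
  by move=> /nbhs_ballP[e /= e_gt0 pe]; exists e => // v hv /pe; exact.
case: (nbhs_subspaceP (affine_hull S) p) => [_|/(_ (sub_hull _ Sp))//].
by apply/nbhs_ballP; exists e => // v pv hv; exact: pe.
Qed.

Lemma relative_interior_opposite {V : normedModType R} (S : set V) (p w : V) :
  relative_interior S p -> S w ->
  exists2 e : R, 0 < e & S ((1 + e) *: p - e *: w).
Proof.
move=> /relative_interiorP[Sp [d d_gt0 pd]] Sw.
have N_gt0 : 0 < 1 + `|w - p| by rewrite ltr_pwDl.
(* The displacement [e *: (p - w)] then has norm below [d]; the added 1 covers [w = p]. *)
exists (d / (1 + `|w - p|)); first by rewrite divr_gt0.
set e := _ / _; have e_gt0 : 0 < e by rewrite divr_gt0.
apply: pd.
  move=> T [affT /(_ _ _)ST].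
  have := affT _ _ (- e) (ST _ Sw) (ST _ Sp).
  by rewrite opprK scaleNr addrC.
rewrite -ball_normE /ball_ /=.
have -> : p - ((1 + e) *: p - e *: w) = e *: (w - p).
  by rewrite scalerDl scale1r opprB scalerBr opprD addrCA addNKr addrC.
rewrite normrZ gtr0_norm // /e mulrAC ltr_pdivrMr //.
by rewrite mulrDr mulr1 ltrDr.
Qed.

Lemma convex_setE {V : lmodType R} (S : set V) :
  convex_set (S : set (convex_lmodType V)) <->
  forall x y (t : R), 0 <= t <= 1 -> S x -> S y -> S (t *: x + (1 - t) *: y).
Proof.
split=> [convS x y t /andP[t_ge0 t_le1] Sx Sy|convS x y t].
  exact: set_mem (convS x y (Itv01 t_ge0 t_le1) (mem_set Sx) (mem_set Sy)).
by rewrite !inE => Sx Sy; apply: convS => //; rewrite ge0 le1.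
Qed.

Lemma convex_set_sum {V : lmodType R} (S : set V) (m : nat)
    (t : 'I_m -> R) (a : 'I_m -> V) :
  convex_set (S : set (convex_lmodType V)) ->
  (forall j, 0 <= t j) -> (forall j, S (a j)) -> \sum_j t j = 1 ->
  S (\sum_j t j *: a j).
Proof.
move=> convS; elim: m t a => [|m IHm] t a t_ge0 Sa.
  by rewrite big_ord0 => /eqP; rewrite eq_sym oner_eq0.
rewrite !big_ord_recl; set t0 := t ord0; set u := \sum_j _ => sum_t.
have u_ge0 : 0 <= u by rewrite sumr_ge0.
have t0_ge0 : 0 <= t0 by exact: t_ge0.
(* Weights of total zero cannot be renormalised for the induction, but then only the first point
   remains. *)
have [u0|u_neq0] := eqVneq u 0.
  rewrite big1 => [|j _]; last first.
    have /eqP := u0; rewrite psumr_eq0 // => /allP/(_ j).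
    by rewrite mem_index_enum => /(_ isT)/eqP ->; rewrite scale0r.
  by rewrite (_ : t0 = 1) ?scale1r ?addr0 // -sum_t u0 addr0.
have Srest : S (\sum_j (u^-1 * t (lift ord0 j)) *: a (lift ord0 j)).
  apply: IHm => //; first by move=> j; rewrite mulr_ge0 ?invr_ge0.
  by rewrite -mulr_sumr mulVf.
have t0_le1 : t0 <= 1 by rewrite -sum_t lerDl.
have t0u : 1 - t0 = u by rewrite -sum_t addrC addKr.
have := (convex_setE S).1 convS (a ord0) _ t0 _ (Sa ord0) Srest.
rewrite t0_ge0 t0_le1 t0u scaler_sumr => /(_ isT); congr (S (_ + _)).
by apply: eq_bigr => j _; rewrite scalerA mulrA mulfV // mul1r.
Qed.

End RelativeInterior.

(** * The cone and the convex hull of the columns of a matrix *)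

Section ColumnCone.

Context {R : realType} {l n : nat} (B : 'M[R]_(l, n)).

Lemma mulmx_small (m k : nat) (M : 'M[R]_(m, k)) (d : R) : 0 < d ->
  exists2 e : R, 0 < e & forall v : 'cV[R]_k, (forall i, `|v i 0| < e) ->
    forall j, `|(M *m v) j 0| < d.
Proof.
(* [N] exceeds the sum of absolute values along every row. *)
move=> d_gt0; pose N := 1 + \sum_j \sum_i `|M j i|.
have N_gt0 : 0 < N by rewrite ltr_pwDl // !sumr_ge0 // => i _; rewrite sumr_ge0.
exists (d / N) => [|v v_lt j]; first by rewrite divr_gt0.
rewrite mxE (le_lt_trans (ler_norm_sum _ _ _)) //.
apply: (@le_lt_trans _ _ ((\sum_i `|M j i|) * (d / N))).
  by rewrite mulr_suml ler_sum // => i _; rewrite normrM ler_wpM2l // ltW.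
rewrite mulrCA gtr_pMr // ltr_pdivrMr // mul1r.
rewrite (@lt_le_trans _ _ (1 + \sum_i `|M j i|)) ?ltrDr //.
by rewrite lerD2l (bigD1 j) //= lerDl sumr_ge0 // => i _; rewrite sumr_ge0.
Qed.

Lemma positive_lower_bound (s : 'cV[R]_n) : (forall j, 0 < s j 0) ->
  exists2 d : R, 0 < d & forall j, d <= s j 0.
Proof.
(* The default 1 keeps the bound positive even for [n = 0]. *)
move=> s_gt0; exists (\big[Num.min/1]_j s j 0); last by move=> j; exact: bigmin_le.
by apply: lt_bigmin => // j _.
Qed.

(** Reduces relative interiority to perturbing coefficients: the affine hull of [S] stays in the
    column space, where [pinvmx B] assigns small coefficients to small vectors. *)
Lemma relative_interior_columns (S : set 'cV[R]_l) (p : 'cV[R]_l) (d : R) :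
  (forall v, S v -> exists x, v = B *m x) -> 0 < d ->
  (forall x : 'cV[R]_n, (forall j, `|x j 0| < d) -> S (p + B *m x)) ->
  relative_interior S p.
Proof.
move=> SB d_gt0 pd; apply/relative_interiorP.
have Sp : S p.
  rewrite -[p]addr0 -(mulmx0 _ B); apply: pd => j.
  by rewrite mxE normr0.
split=> //; have [y py] := SB _ Sp.
have [e e_gt0 eP] := mulmx_small _ _ (pinvmx B) d d_gt0.
exists e => // v hv [_ pv].
have [x vx] : exists x, v = B *m x.
  apply: (hv [set w | exists x, w = B *m x]); split=> // _ _ t [x1 ->] [x2 ->].
  by exists (t *: x1 + (1 - t) *: x2); rewrite mulmxDr -!scalemxAr.
have -> : v = p + B *m (pinvmx B *m (v - p)).
  rewrite {1}vx {1}py vx py -mulmxBr.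
  have -> : B *m (pinvmx B *m (B *m (x - y))) = B *m (x - y).
    by rewrite 2!mulmxA mulmxKpV.
  by rewrite -mulmxDr addrC subrK.
apply: pd => j; apply: eP => i; rewrite !mxE distrC.
by have := pv i 0; rewrite -ball_normE.
Qed.

Lemma positive_combination_relative_interior (S : set 'cV[R]_l) (p w : 'cV[R]_l) :
  (forall v, S v -> exists2 x : 'cV[R]_n, (forall j, 0 <= x j 0) & v = B *m x) ->
  relative_interior S p -> S w -> positive_combination B w ->
  positive_combination B p.
Proof.
move=> SB Sp Sw [s [s_gt0 sw]].
have [e e_gt0 /SB[x x_ge0 xE]] := relative_interior_opposite _ _ _ Sp Sw.
have e1_gt0 : 0 < 1 + e by lra.
(* Obtained by solving [(1 + e) *: p - e *: w = B *m x] for [p]; the summand [e *: s] makes all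
   coefficients positive. *)
exists ((1 + e)^-1 *: (x + e *: s)); split=> [j|].
  by rewrite !mxE mulr_gt0 ?invr_gt0 // ltr_wpDl // mulr_gt0.
rewrite -scalemxAr mulmxDr -scalemxAr -xE sw subrK scalerA mulVf ?scale1r //.
by rewrite gt_eqF.
Qed.

Definition cone : set 'cV[R]_l :=
  [set v | exists2 x : 'cV[R]_n, (forall j, 0 <= x j 0) & v = B *m x].

Lemma relative_interior_cone (v : 'cV[R]_l) :
  relative_interior cone v <-> positive_combination B v.
Proof.
split=> [|[s [s_gt0 <-]]].
  move=> cv; have one_gt0 j : 0 < (const_mx 1 : 'cV[R]_n) j 0 by rewrite mxE.
  apply: (positive_combination_relative_interior _ _ (B *m const_mx 1) _ cv) => //.
  - by exists (const_mx 1) => // j; exact: ltW.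
  - by exists (const_mx 1).
have [d d_gt0 d_le] := positive_lower_bound s s_gt0.
apply: (relative_interior_columns _ _ d) => //.
  by move=> _ [x _ ->]; exists x.
move=> x x_lt; exists (s + x); last by rewrite mulmxDr.
move=> j; rewrite mxE; have := x_lt j; rewrite ltr_norml => /andP[].
by have := d_le j; lra.
Qed.

Lemma convex_hull_columns (v : 'cV[R]_l) :
  convex_hull (range (fun j => col j B)) v <->
  exists x : 'cV[R]_n, [/\ forall j, 0 <= x j 0, \sum_j x j 0 = 1 & v = B *m x].
Proof.
split=> [hv|[x [x_ge0 sum_x ->]]]; last first.
  move=> S [convS colS].
  have -> : B *m x = \sum_j x j 0 *: col j B.
    apply/matrixP=> i k; rewrite (ord1 k) mxE summxE.
    by apply: eq_bigr => j _; rewrite !mxE mulrC.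
  by apply: convex_set_sum => // j; apply: colS; exists j.
apply: (hv [set v | exists x : 'cV[R]_n,
  [/\ forall j, 0 <= x j 0, \sum_j x j 0 = 1 & v = B *m x]]); split.
  apply/convex_setE => v1 v2 t /andP[t_ge0 t_le1].
  move=> [x [x_ge0 sum_x ->]] [y [y_ge0 sum_y ->]].
  exists (t *: x + (1 - t) *: y); split.
  - by move=> j; rewrite !mxE addr_ge0 // mulr_ge0 // subr_ge0.
  - under eq_bigr do rewrite !mxE.
    by rewrite big_split /= -!mulr_sumr sum_x sum_y; ring.
  - by rewrite mulmxDr -!scalemxAr.
move=> _ [j _ <-]; exists (delta_mx j 0); split; last by rewrite colE.
- by move=> k; rewrite mxE ler0n.
- rewrite (bigD1 j) //= mxE !eqxx big1 ?addr0 // => k kj.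
  by rewrite mxE (negPf kj).
Qed.

(** Forward, the barycentre of the columns is the strictly positive point of the hull. Backward, a
    perturbation [x] of the normalised weights [u] is corrected by a multiple of [u], which restores
    total weight 1 and leaves the image unchanged because [B *m u = 0]. *)
Lemma relative_interior_convex_hull0 : (0 < n)%N ->
  relative_interior (convex_hull (range (fun j => col j B))) 0 <->
  positive_combination B 0.
Proof.
move=> n_gt0; have n_neq0 : n%:R != 0 :> R by rewrite pnatr_eq0 -lt0n.
split=> [h0|[s [s_gt0 Bs0]]].
  have u_gt0 j : 0 < (const_mx n%:R^-1 : 'cV[R]_n) j 0.
    by rewrite mxE invr_gt0 ltr0n.
  apply: (positive_combination_relative_interior _ _ (B *m const_mx n%:R^-1) _ h0).
  - by move=> v /convex_hull_columns[x [x_ge0 _ ->]]; exists x.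
  - apply/convex_hull_columns; exists (const_mx n%:R^-1); split=> // [j|].
      exact: ltW.
    under eq_bigr do rewrite mxE.
    by rewrite sumr_const card_ord -[LHS]mulr_natr mulVf.
  - by exists (const_mx n%:R^-1).
have S_gt0 : 0 < \sum_j s j 0.
  by rewrite (bigD1 (Ordinal n_gt0)) //= ltr_wpDr // sumr_ge0 // => j _; exact: ltW.
pose S := \sum_j s j 0; pose u := S^-1 *: s.
have u_gt0 j : 0 < u j 0 by rewrite mxE mulr_gt0 ?invr_gt0.
have sum_u : \sum_j u j 0 = 1.
  by under eq_bigr do rewrite mxE; rewrite -mulr_sumr mulVf // gt_eqF.
have Bu0 : B *m u = 0 by rewrite -scalemxAr Bs0 scaler0.
have [d d_gt0 d_le] := positive_lower_bound u u_gt0.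
(* This matrix is the projection along [u] onto the vectors with coordinate sum 0. *)
have [e e_gt0 eP] := mulmx_small _ _ (1%:M - u *m const_mx 1) d d_gt0.
apply: (relative_interior_columns _ _ e) => //.
  by move=> v /convex_hull_columns[x [_ _ ->]]; exists x.
move=> x x_lt; rewrite add0r; apply/convex_hull_columns.
have tE : (1%:M - u *m const_mx 1) *m x = x - (\sum_j x j 0) *: u.
  rewrite mulmxBl mul1mx -mulmxA; congr (_ - _).
  apply/matrixP=> i k; rewrite !mxE big_ord1 (ord1 k) mulrC !mxE.
  by congr (_ * _); apply: eq_bigr => j _; rewrite mxE mul1r.
exists (u + (x - (\sum_j x j 0) *: u)); split.
- move=> j; rewrite -tE mxE; have := eP _ x_lt j; rewrite ltr_norml => /andP[].
  by have := d_le j; lra.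
- transitivity (\sum_j (u j 0 + (x j 0 - (\sum_k x k 0) * u j 0))).
    by apply: eq_bigr => j _; rewrite !mxE.
  by rewrite big_split sumrB /= -mulr_sumr sum_u; ring.
- by rewrite mulmxDr Bu0 mulmxBr -scalemxAr Bu0 scaler0 add0r subr0.
Qed.

End ColumnCone.

(** * The moment map in terms of squared moduli, and its sign changes *)

Section MomentMap.

Context {R : realType} {l n : nat} (A : 'M[int]_(l, n)).

(** The squared modulus as an element of [R]; the norm of [R[i]] takes its values in [R[i]]. *)
Definition sqmod (w : R[i]) : R := complex.Re w ^+ 2 + complex.Im w ^+ 2.

Definition sqmod_mx (z : complexV R n) : 'cV[R]_n := \col_j sqmod (z j 0).

Lemma sqmod_ge0 (w : R[i]) : 0 <= sqmod w.
Proof. by rewrite addr_ge0 ?sqr_ge0. Qed.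

Lemma sqmodE (w : R[i]) : (sqmod w)%:C%C = w * w^*%C.
Proof.
case: w => a b; apply/eqP; rewrite eq_complex /= !mulrN opprK -!expr2 eqxx.
by rewrite [b * a]mulrC addNr eqxx.
Qed.

Lemma sqmod_normE (w : R[i]) : `|w| = (Num.sqrt (sqmod w))%:C%C.
Proof. exact: normc_def. Qed.

Lemma sqmodM (v w : R[i]) : sqmod (v * w) = sqmod v * sqmod w.
Proof. by case: v w => [a b] [c d]; rewrite /sqmod /=; ring. Qed.

Lemma sqmod_real (t : R) : sqmod t%:C%C = t ^+ 2.
Proof. by rewrite /sqmod /= expr0n addr0. Qed.

Lemma sqmod_eq0 (w : R[i]) : (sqmod w == 0) = (w == 0).
Proof. by rewrite paddr_eq0 ?sqr_ge0 // !sqrf_eq0 [RHS]eq_complex. Qed.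

Lemma sqmod0 : sqmod 0 = 0.
Proof. by apply/eqP; rewrite sqmod_eq0. Qed.

Lemma moment_mapE (z : complexV R n) :
  moment_map A z = real_mx R A *m sqmod_mx z.
Proof.
apply/matrixP=> i k; rewrite (ord1 k).
apply: complexI; rewrite moment_map_real [in RHS]mxE rmorph_sum.
by apply: eq_bigr => j _; rewrite rmorphM /= !mxE sqmodE rmorph_int mulrA.
Qed.

Lemma range_moment_map : range (moment_map A) = cone (real_mx R A).
Proof.
apply/seteqP; split=> [_ [z _ <-]|_ [x x_ge0 ->]].
  by exists (sqmod_mx z); [move=> j; rewrite mxE sqmod_ge0|exact: moment_mapE].
exists (\col_j (Num.sqrt (x j 0))%:C%C) => //; rewrite moment_mapE; congr (_ *m _).
by apply/matrixP=> j k; rewrite (ord1 k) !mxE sqmod_real sqr_sqrtr.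
Qed.

(* Small dilations change the modulus in both directions, except at [0]. *)
Lemma sqmod_perturb (w e : R[i]) : 0 < e ->
  (exists2 w', `|w - w'| < e & sqmod w < sqmod w') /\
  (w != 0 -> exists2 w', `|w - w'| < e & sqmod w' < sqmod w).
Proof.
(* The radius has type [R[i]]; being positive, it is a real [k]. *)
case: e => e e' /[dup] /gtr0_real /complex_realP[k [-> ->]] {e e'}.
rewrite ltcR => k_gt0.
have [->|w_neq0] := eqVneq w 0.
  split=> //; exists (k / 2)%:C%C.
    by rewrite sub0r normrN sqmod_normE sqmod_real sqrtr_sqr ltcR gtr0_norm; lra.
  by rewrite sqmod0 sqmod_real exprn_gt0 ?divr_gt0.
have q_gt0 : 0 < sqmod w by rewrite lt_neqAle eq_sym sqmod_eq0 w_neq0 sqmod_ge0.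
pose N := Num.sqrt (sqmod w).
have N_gt0 : 0 < N by rewrite sqrtr_gt0.
(* As [N] is the modulus of [w], scaling [w] by [1 + d] or [1 - d] moves it by [d * N < k]; [d < 1]
   ensures that [1 - d] shrinks it. *)
have [d [d_gt0 d_lt1 dN]] : exists d : R, [/\ 0 < d, d < 1 & d * N < k].
  exists (Num.min (1 / 2) (k / (2 * N))); split.
  - by rewrite lt_min !divr_gt0 ?mulr_gt0.
  - by rewrite gt_min; apply/orP; left; lra.
  - rewrite -ltr_pdivlMr // gt_min; apply/orP; right.
    by rewrite ltr_pM2l // invfM; rewrite gtr_pMl ?invr_gt0 //; lra.
have near t : `|t| = d -> `|w - (1 + t)%:C%C * w| < k%:C%C.
  move=> td; rewrite -{1}[w]mul1r -mulrBl -(rmorph1 (real_complex R)) -rmorphB.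
  by rewrite sqmod_normE sqmodM sqmod_real sqrtrM ?sqr_ge0 // sqrtr_sqr ltcR
    opprD addrA subrr add0r normrN td.
split=> [|_].
  exists ((1 + d)%:C%C * w); first by apply: near; exact: gtr0_norm.
  by rewrite sqmodM sqmod_real ltr_pMl //; nra.
exists ((1 - d)%:C%C * w); first by apply: near; rewrite normrN gtr0_norm.
by rewrite sqmodM sqmod_real gtr_pMl //; nra.
Qed.

(** Balls of column vectors are products of balls, so one coordinate can be moved while the others
    stay fixed. *)
Lemma open_nbhs_perturb (z : complexV R n) (U : set (complexV R n)) (j : 'I_n) :
  open_nbhs z U ->
  (exists2 z', U z' & sqmod (z j 0) < sqmod (z' j 0) /\
     forall k, k != j -> z' k 0 = z k 0) /\
  (z j 0 != 0 -> exists2 z', U z' & sqmod (z' j 0) < sqmod (z j 0) /\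
     forall k, k != j -> z' k 0 = z k 0).
Proof.
rewrite open_nbhsE => -[_ /nbhs_ballP[e /= e_gt0 zU]].
pose upd w : complexV R n := \col_k if k == j then w else z k 0.
have updU (w : R[i]) : `|z j 0 - w| < e -> U (upd w).
  move=> zw; apply: zU; split=> // i k; rewrite (ord1 k) mxE.
  have [->|_] := eqVneq i j; first by rewrite -ball_normE.
  exact: ballxx.
have updj w : upd w j 0 = w by rewrite mxE eqxx.
have updk w k : k != j -> upd w k 0 = z k 0 by rewrite mxE => /negPf ->.
have [[w' zw ltw] small] := sqmod_perturb (z j 0) e e_gt0.
split; first by exists (upd w'); [exact: updU|rewrite updj; split=> // k /updk].
move=> /small[w zw2 ltw2].
by exists (upd w); [exact: updU|rewrite updj; split=> // k /updk].
Qed.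

Lemma component_shifted_moment_map (mu : 'cV[R]_l) (xi : 'cV[R]_l)
    (zeta z : complexV R n) : moment_map A zeta = mu ->
  component (fun z => moment_map A z - mu) xi z =
  \sum_j (xi^T *m real_mx R A) 0 j * (sqmod (z j 0) - sqmod (zeta j 0)).
Proof.
move=> <-; rewrite !moment_mapE.
transitivity ((xi^T *m (real_mx R A *m (sqmod_mx z - sqmod_mx zeta))) 0 0).
  rewrite mulmxBr [RHS]mxE; apply: eq_bigr => i _.
  by rewrite moment_mapE [in RHS]mxE.
rewrite mulmxA [LHS]mxE; apply: eq_bigr => j _; congr (_ * _).
by rewrite !mxE.
Qed.

Lemma positive_combination_changes_sign (mu : 'cV[R]_l) :
  positive_combination (real_mx R A) mu <->
  (exists z, moment_map A z = mu) /\
  forall zeta, moment_map A zeta = mu ->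
    changes_sign_at (fun z => moment_map A z - mu) zeta.
Proof.
split=> [[s [s_gt0 sE]]|[[z Jz] sgn]].
  split.
    have : cone (real_mx R A) mu by exists s => // j; exact: ltW.
    by rewrite -range_moment_map => -[z _ zE]; exists z.
  move=> zeta Jzeta xi; pose c j := (xi^T *m real_mx R A) 0 j.
  have [c0|] := pselect (forall j, c j = 0).
    left; exists setT; split=> [|m _]; first by apply: open_nbhsT.
    rewrite (component_shifted_moment_map _ _ zeta) // big1 // => j _.
    by rewrite -/(c j) c0 mul0r.
  move=> /existsNP[j0 /eqP cj0]; right => U zU.
  have one j (z : complexV R n) : (forall k, k != j -> z k 0 = zeta k 0) ->
      component (fun z => moment_map A z - mu) xi z =
      c j * (sqmod (z j 0) - sqmod (zeta j 0)).
    move=> zk; rewrite (component_shifted_moment_map _ _ zeta) //.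
    rewrite (bigD1 j) //= big1 ?addr0 // => k kj.
    by rewrite zk // subrr mulr0.
  have posj j : 0 < c j -> exists2 m, U m &
      0 < component (fun z => moment_map A z - mu) xi m.
    move=> cj; have [[m Um [lt_m m_eq]] _] := open_nbhs_perturb zeta U j zU.
    by exists m => //; rewrite (one j) // mulr_gt0 // subr_gt0.
  have negj j : c j < 0 -> exists2 m, U m &
      component (fun z => moment_map A z - mu) xi m < 0.
    move=> cj; have [[m Um [lt_m m_eq]] _] := open_nbhs_perturb zeta U j zU.
    by exists m => //; rewrite (one j) // nmulr_rlt0 // subr_gt0.
  have [[j [cj zj]]|all0] := pselect (exists j, c j != 0 /\ zeta j 0 != 0).
    have [_ /(_ zj)[m Um [lt_m m_eq]]] := open_nbhs_perturb zeta U j zU.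
    have [cj_lt0|cj_gt0|cj_eq0] := ltgtP (c j) 0; last by rewrite cj_eq0 eqxx in cj.
      have [m2 Um2 m2_lt0] := negj j cj_lt0; exists m, m2; split=> //.
      by rewrite (one j) // nmulr_rgt0 // subr_lt0.
    have [m1 Um1 m1_gt0] := posj j cj_gt0; exists m1, m; split=> //.
    by rewrite (one j) // pmulr_rlt0 // subr_lt0.
  (* Now [xi] vanishes at [mu], hence cannot be nonnegative or nonpositive on
     all the columns, as [mu] is a strictly positive combination of them. *)
  have cs0 : \sum_j c j * s j 0 = 0.
    transitivity ((xi^T *m mu) 0 0); first by rewrite -sE mulmxA mxE.
    rewrite -Jzeta moment_mapE mulmxA mxE big1 // => j _.
    rewrite -/(c j); have [->|cj] := eqVneq (c j) 0; first by rewrite mul0r.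
    rewrite mxE; have [->|zj] := eqVneq (zeta j 0) 0; last by case: all0; exists j.
    by rewrite sqmod0 mulr0.
  have [[jp cjp]|nop] := pselect (exists j, 0 < c j); last first.
    have : \sum_j - (c j * s j 0) = 0 by rewrite sumrN cs0 oppr0.
    have ge0 j : 0 <= - (c j * s j 0).
      rewrite oppr_ge0 pmulr_lle0 // leNgt; apply/negP=> cj.
      by apply: nop; exists j.
    move/eqP; rewrite psumr_eq0 // => /allP/(_ j0).
    rewrite mem_index_enum => /(_ isT); rewrite oppr_eq0 mulf_eq0 (negPf cj0) /=.
    by rewrite gt_eqF.
  have [[jn cjn]|non] := pselect (exists j, c j < 0); last first.
    have ge0 j : 0 <= c j * s j 0.
      rewrite pmulr_lge0 // leNgt; apply/negP=> cj.
      by apply: non; exists j.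
    move/eqP: cs0; rewrite psumr_eq0 // => /allP/(_ j0).
    rewrite mem_index_enum => /(_ isT); rewrite mulf_eq0 (negPf cj0) /=.
    by rewrite gt_eqF.
  have [m1 Um1 m1_gt0] := posj jp cjp; have [m2 Um2 m2_lt0] := negj jn cjn.
  by exists m1, m2.
have z_ge0 k : 0 <= sqmod_mx z k 0 by rewrite mxE sqmod_ge0.
have [|[xi [xi_ge0 [j xij] xi0]]] :=
  positive_or_supported _ (real_mx R A) (sqmod_mx z) z_ge0.
  by rewrite -moment_mapE Jz.
have comp m : component (fun z => moment_map A z - mu) xi^T m =
    \sum_k (xi *m real_mx R A) 0 k * sqmod (m k 0).
  rewrite (component_shifted_moment_map _ _ z) // trmxK.
  transitivity (\sum_k (xi *m real_mx R A) 0 k * sqmod (m k 0) -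
                (xi *m (real_mx R A *m sqmod_mx z)) 0 0); last first.
    by rewrite xi0 mxE subr0.
  rewrite mulmxA [in RHS]mxE -sumrB; apply: eq_bigr => k _.
  by rewrite mulrBr [sqmod_mx z k 0]mxE.
(* Both clauses fail for [xi^T]: enlarging the modulus of the [j]-th coordinate makes the component
   positive arbitrarily near [z], and the component is nonnegative everywhere. *)
have [[U [zU U0]]|both] := sgn z Jz xi^T.
  have [[m Um [lt_m _]] _] := open_nbhs_perturb z U j zU.
  have := U0 _ Um; rewrite comp => /eqP; rewrite psumr_eq0 => [|k _]; last first.
    by rewrite mulr_ge0 ?sqmod_ge0.
  move=> /allP/(_ j); rewrite mem_index_enum => /(_ isT).
  by rewrite mulf_eq0 !gt_eqF // (le_lt_trans _ lt_m) ?sqmod_ge0.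
have [_ [m [_ _ _]]] := both setT (open_nbhsT z).
by rewrite comp ltNge sumr_ge0 // => k _; rewrite mulr_ge0 ?sqmod_ge0.
Qed.

End MomentMap.

(** * The image as a vector subspace, and the equivalences *)

(** Uses the full-rank factorisation of [B]: [col_base B] is injective, which gives the dimension,
    and [row_base B] is surjective, so no column vector is lost. *)
Lemma column_space_vspace {F : fieldType} {l n : nat} (B : 'M[F]_(l, n)) :
  exists2 V : {vspace 'cV[F]_l}, \dim V = \rank B &
    forall v, v \in V <-> exists x, v = B *m x.
Proof.
pose f : 'Hom('cV[F]_(\rank B), 'cV[F]_l) := linfun (mulmx (col_base B)).
have fE x : f x = col_base B *m x by rewrite lfunE.
have BE (x : 'cV_n) : B *m x = col_base B *m (row_base B *m x).
  by rewrite mulmxA mulmx_base.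
have ker0 : lker f == 0%VS.
  apply/lker0P => x y; rewrite !fE => /(congr1 (mulmx (pinvmx (col_base B)))).
  by do 2!rewrite mulmxA mulVpmx ?col_base_full // mul1mx.
exists (limg f) => [|v].
  by rewrite limg_dim_eq ?(eqP ker0) ?capv0 // dimvf /dim /= muln1.
split=> [/memv_imgP[x _ ->]|[x ->]].
  exists (pinvmx (row_base B) *m x); rewrite fE BE.
  by rewrite (mulmxA (row_base B)) mulmxVp ?row_base_free // mul1mx.
by rewrite BE -fE memv_img // memvf.
Qed.

(** Adding a large multiple of a positive kernel vector makes any coefficients nonnegative, so the
    cone fills the column space. Conversely, a subspace contains the opposite of the sum of the
    columns; adding that sum writes 0 with all coefficients at least 1. *)
Lemma positive_combination0_cone_subspace {R : realType} {l n : nat}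
    (B : 'M[R]_(l, n)) :
  positive_combination B 0 <->
  exists V : {vspace 'cV[R]_l}, cone B = [set` V] /\ \dim V = \rank B.
Proof.
split=> [[s [s_gt0 Bs0]]|[V [coneV _]]].
  have [V dimV VP] := column_space_vspace B; exists V; split=> //.
  apply/seteqP; split=> [v [x _ vx]|v /VP[x ->]]; first by apply/VP; exists x.
  (* The sum serves as an upper bound for all the ratios at once. *)
  pose c := \sum_j `|x j 0| / s j 0.
  have c_ge j : `|x j 0| / s j 0 <= c.
    rewrite /c (bigD1 j) //= lerDl sumr_ge0 // => k _.
    by rewrite divr_ge0 // ltW.
  exists (x + c *: s); last by rewrite mulmxDr -scalemxAr Bs0 scaler0 addr0.
  move=> j; rewrite !mxE; have := c_ge j; rewrite ler_pdivrMr // => xc.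
  by have := ler_norm (- x j 0); rewrite normrN; lra.
have : cone B (B *m const_mx 1) by exists (const_mx 1) => // j; rewrite mxE.
rewrite coneV /= => sumV.
have : cone B (- (B *m const_mx 1)) by rewrite coneV /= rpredN.
move=> [x x_ge0 xE]; exists (x + const_mx 1); split=> [j|].
  by rewrite !mxE ltr_wpDl.
by rewrite mulmxDr -xE addNr.
Qed.

Theorem proposition2p2 (R : realType) (l n r : nat) (A : 'M[int]_(l, n))
    (A_neq0 : A <> 0) (rank_A : \rank (real_mx R A) = r) :
  let J : complexV R n -> 'cV[R]_l := moment_map A in
  [<-> (forall zeta, (J @^-1` [set 0]) zeta -> changes_sign_at J zeta);
       (exists V : {vspace 'cV[R]_l}, range J = [set` V] /\ \dim V = r);
       relative_interior (convex_hull (range (fun j => col j (real_mx R A)))) 0]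
  /\
  (forall mu : 'cV[R]_l,
     relative_interior (range J) mu <->
     (J @^-1` [set mu] !=set0 /\
      let J_mu := fun z => J z - mu in
      forall zeta, (J_mu @^-1` [set 0]) zeta -> changes_sign_at J_mu zeta)).
Proof.
move=> J; have n_gt0 : (0 < n)%N.
  rewrite lt0n; apply/eqP => n0; apply: A_neq0; apply/matrixP=> i j.
  by have := ltn_ord j; rewrite {2}n0.
(* The origin makes the zero fibre nonempty, so the criterion at [mu = 0] reduces to the sign
   condition alone. *)
have J0 : J 0 = 0.
  by rewrite /J moment_mapE (_ : sqmod_mx 0 = 0) ?mulmx0 //;
    apply/matrixP=> i j; rewrite !mxE sqmod0.
have signP : positive_combination (real_mx R A) 0 <->
    forall zeta, (J @^-1` [set 0]) zeta -> changes_sign_at J zeta.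
  rewrite positive_combination_changes_sign.
  have -> : (fun z => moment_map A z - 0) = J by apply/funext => z; rewrite subr0.
  by split=> [[_]//|sgn]; split=> //; exists 0.
have vspaceP := positive_combination0_cone_subspace (real_mx R A).
have hullP := relative_interior_convex_hull0 (real_mx R A) n_gt0.
rewrite range_moment_map -{}rank_A; split.
  (* Each implication of the cycle passes through [positive_combination (real_mx R A) 0]. *)
  tfae.
  - by move=> /signP/vspaceP.
  - by move=> /vspaceP/hullP.
  - by move=> /hullP/signP.
move=> mu; rewrite relative_interior_cone positive_combination_changes_sign.
have shiftP z : J z - mu = 0 <-> J z = mu.
  by split=> [/eqP|->]; rewrite ?subrr // subr_eq0 => /eqP.
split=> [[[z zmu] sgn]|[[z zmu] sgn]]; split; try by exists z.
  by move=> J_mu zeta /shiftP; exact: sgn.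
by move=> zeta /shiftP; exact: sgn.
Qed.
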